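(* Let $\mathcal{B}=(a_1,a_2)\subset\mathbb{R}$ and, for arbitrary $\tau\in\mathbb{R}^+$, let $\mathcal{B}_\tau=[0,\tau]\times\mathcal{B}$ with coordinates $z=(z_0,z_1)=(t,x)$ and $\partial_\mu=\partial/\partial z_\mu$. Let $\rho_0$ (the material density) and $c$ (the elastic modulus) be constants, and let $\sigma(\partial_0 I,\partial_1 I)=\tfrac12\left(\rho_0(\partial_0 I)^2-c(\partial_1 I)^2\right)$, where the scalar field $I$ (the total energy) satisfies the Euler–Lagrange equation $$\frac{\partial}{\partial z_\mu}\left(\frac{\partial\sigma}{\partial(\partial_\mu I)}\right)=0 .$$ Assume that $\sigma$ is invariant under the one-parameter group of transformations $\lambda\mapsto I_\lambda$, with associated vector field $K_\mu$ (invariance as defined in the context). Then the Euler–Lagrange system corresponding to $\sigma$ admits the conservation law $$\frac{\partial P_\mu}{\partial z_\mu}=0,$$ where the conserved current $P_\mu$ is defined as $$P_\mu=\frac{\partial\sigma}{\partial(\partial_\mu I)}\cdot\frac{\partial I_\lambda}{\partial\lambda}\Big|_{\lambda=0}-K_\mu .$$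
   Context: The repeated index $\mu\in\{0,1\}$ is summed. A one-parameter smooth transformation $\lambda\in[0,\infty)\mapsto I_\lambda=I(z_\mu;\lambda)$ with $I_\lambda|_{\lambda=0}=I$ is given, and $\sigma_\lambda=\sigma(\partial_\mu I_\lambda)$. The function $\sigma$ is said to be invariant under the one-parameter group of transformations $\lambda\mapsto I_\lambda$ if $$\frac{d}{d\lambda}\int_{\mathcal{B}_\tau}\sigma_\lambda\Big|_{\lambda=0}\,d^2z=\int_{\mathcal{B}_\tau}\frac{\partial K_\mu}{\partial z_\mu}\,d^2z$$ for some (possibly zero) vector field $K=(K_0,K_1)$, $K_\mu=K_\mu(I,\partial_0 I,\partial_1 I)$.
   Formalization: Invariance is required on [0,τ]×(b1,b2) for every subinterval (b1,b2) of B, not only on B_τ (with B alone the claim fails: I=x, I_λ=x+λx(1−x), K=0, B=(0,1)); K_μ is taken to be a smooth function on all of R^3. *)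

(* Defs.v *)
From HB Require Import structures.
From mathcomp Require Import all_boot all_order all_algebra.
From mathcomp Require Import all_classical all_reals all_analysis.

Set Implicit Arguments.
Unset Strict Implicit.
Unset Printing Implicit Defensive.

Import Order.TTheory GRing.Theory Num.Theory.
Import numFieldNormedType.Exports.

Local Open Scope classical_set_scope.
Local Open Scope ring_scope.

(* The domains below, [0, +oo[ x ]a1, a2[ for z = (t, x) and [0, +oo[ for
   lambda, contain part of their boundary, so derivatives are taken relative to
   the domain: the increments h are those for which h *: v + z stays in D.  This
   is 'D_v f z when D is a neighbourhood of z, and a one-sided derivative at
   t = 0 or lambda = 0. *)
Section derivative_within.
Context {R : realType} {V : normedModType R}.
Implicit Types (D : set V) (f : V -> R).

Definition quotient_within D f (z v : V) : set_system R :=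
  (fun h : R => h^-1 * (f (h *: v + z) - f z))
    @ within [set h : R | D (h *: v + z)] (0 : R)^'.

Definition is_derive_within D f (z v : V) (l : R) : Prop :=
  quotient_within D f z v --> l.

Definition derivable_within D f (z v : V) : Prop :=
  exists l : R, is_derive_within D f z v l.

Definition derive_within D f (z v : V) : R := lim (quotient_within D f z v).

(* At a corner of D some directions v admit no increment, and the condition on
   g z v is then void; g is determined there by its continuity on D. *)
Fixpoint Ck_within D (k : nat) f : Prop :=
  {within D, continuous f} /\
  if k is k'.+1 then
    forall v : V, exists g : V -> R,
      (forall z, D z -> is_derive_within D f z v (g z)) /\ Ck_within D k' g
  else True.

Definition smooth_within D f : Prop := forall k, Ck_within D k f.

End derivative_within.

Section noether.
Context {R : realType}.

(* z = (z_0, z_1) = (t, x) is a row vector; e mu is the mu-th unit vector. *)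
Definition e (mu : 'I_2) : 'rV[R]_2 := delta_mx 0 mu.

Definition event (t x : R) : 'rV[R]_2 := t *: e 0 + x *: e 1.

Definition spacetime (a1 a2 : R) : set 'rV[R]_2 :=
  [set z | 0 <= z 0 0 /\ a1 < z 0 1 < a2].

Definition sigma (rho0 c : R) (p : 'rV[R]_2) : R :=
  2^-1 * (rho0 * p 0 0 ^+ 2 - c * p 0 1 ^+ 2).

Section body.
Variables (a1 a2 : R).
Let D := spacetime a1 a2.

Definition partial (mu : 'I_2) (f : 'rV[R]_2 -> R) (z : 'rV[R]_2) : R :=
  derive_within D f z (e mu).

Definition grad (f : 'rV[R]_2 -> R) (z : 'rV[R]_2) : 'rV[R]_2 :=
  \row_mu partial mu f z.

Definition divergence (F : 'I_2 -> 'rV[R]_2 -> R) (z : 'rV[R]_2) : R :=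
  \sum_(mu < 2) partial mu (F mu) z.

(* The partial derivative of s in its mu-th argument, taken along f. *)
Definition momentum (s : 'rV[R]_2 -> R) (f : 'rV[R]_2 -> R) (mu : 'I_2)
    (z : 'rV[R]_2) : R :=
  'D_(e mu) s (grad f z).

Definition euler_lagrange (s f : 'rV[R]_2 -> R) : Prop :=
  forall z, D z -> divergence (momentum s f) z = 0.

Definition slab_integral (tau b1 b2 : R) (f : 'rV[R]_2 -> R) : R :=
  (\int[(lebesgue_measure \x lebesgue_measure)%E]_(p in `[0%R, tau] `*` `]b1, b2[)
     f (event p.1 p.2))%R.

(* Il is lambda |-> I_lambda; only lambda >= 0 matters. *)
Definition transformation_of (Il : R -> 'rV[R]_2 -> R) (f : 'rV[R]_2 -> R)
    : Prop :=
  smooth_within (D `*` (`[0, +oo[ : set R)) (fun w : 'rV[R]_2 * R => Il w.2 w.1) /\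
  forall z, D z -> Il 0 z = f z.

Definition generator (Il : R -> 'rV[R]_2 -> R) (z : 'rV[R]_2) : R :=
  derive_within (`[0, +oo[ : set R) (fun lam : R => Il lam z) 0 1.

Definition along (K : 'I_2 -> R * 'rV[R]_2 -> R) (f : 'rV[R]_2 -> R)
    (mu : 'I_2) (z : 'rV[R]_2) : R :=
  K mu (f z, grad f z).

(* The identity is required on [0, tau] x ]b1, b2[ for every portion ]b1, b2[
   of the body ]a1, a2[, the whole body included.  On the whole body alone it
   would only give the vanishing of the integral over x of the divergence of
   the current: for f(t, x) = x, I_lambda = x + lambda x (1 - x), K = 0 and the
   body ]0, 1[ it holds for every tau, while the divergence is -c (1 - 2 x). *)
Definition variational_invariance (s : 'rV[R]_2 -> R) (Il : R -> 'rV[R]_2 -> R)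
    (f : 'rV[R]_2 -> R) (K : 'I_2 -> R * 'rV[R]_2 -> R) : Prop :=
  forall tau b1 b2 : R, 0 < tau -> a1 <= b1 -> b1 < b2 -> b2 <= a2 ->
    is_derive_within (`[0, +oo[ : set R)
      (fun lam : R => slab_integral tau b1 b2 (fun z => s (grad (Il lam) z)))
      0 1
      (slab_integral tau b1 b2 (divergence (along K f))).

Definition current (s : 'rV[R]_2 -> R) (Il : R -> 'rV[R]_2 -> R)
    (f : 'rV[R]_2 -> R) (K : 'I_2 -> R * 'rV[R]_2 -> R)
    (mu : 'I_2) (z : 'rV[R]_2) : R :=
  momentum s f mu z * generator Il z - along K f mu z.

Definition conservation_law (P : 'I_2 -> 'rV[R]_2 -> R) : Prop :=
  forall z, D z ->
    (forall mu, derivable_within D (P mu) z (e mu)) /\ divergence P z = 0.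

End body.
End noether.

(* Main.v *)
Require Import Defs.
From mathcomp Require Import all_boot all_order all_algebra.
From mathcomp Require Import all_classical all_reals all_analysis.
From mathcomp Require Import lra ring.

(** Write S for sigma(grad I_lambda).  By the mean value theorem in lambda, the
    difference quotients of S are close to dS/dlambda at lambda = 0, uniformly on
    small boxes; taking differences of two slabs, invariance then forces
    dS/dlambda = div K at every point.  Moreover
    dS/dlambda = sum_mu p_mu d_lambda d_mu I_lambda with p_mu the momenta, and
    exchanging the derivatives turns this into sum_mu p_mu d_mu G, where G is the
    generator.  Since sum_mu d_mu p_mu = 0 by the Euler-Lagrange equation, it is
    sum_mu d_mu (p_mu G), so div P = 0. *)

Set Implicit Arguments.
Unset Strict Implicit.
Unset Printing Implicit Defensive.

Import Order.TTheory GRing.Theory Num.Theory.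
Import numFieldNormedType.Exports.
Local Open Scope classical_set_scope.
Local Open Scope ring_scope.

(** * Convexity and continuity on a subset *)

(** Phrased with the increments [h *: v + z] of [is_derive_within], so that any admissible increment
    may be shrunk by a factor in [0, 1]. *)
Definition convex_domain {R : realType} {V : normedModType R} (D : set V) :=
  forall z v h s, D z -> D (h *: v + z) -> 0 <= s <= 1 -> D ((s * h) *: v + z).

Lemma within_continuousT_comp {T U W : topologicalType} (A : set T) (B : set U)
    (f : T -> U) (g : U -> W) :
  (forall x, A x -> B (f x)) -> {within A, continuous f} ->
  {within B, continuous g} -> {within A, continuous (g \o f)}.
Proof.
move=> AB /subspace_continuousP cf /subspace_continuousP cg.
apply/subspace_continuousP => x Ax; apply: cvg_comp (cg _ (AB _ Ax)).
move=> P HP.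
have H : nbhs x (fun y => A y -> B (f y) -> P (f y)) := cf _ Ax _ HP.
by apply: filterS H => y H Ay; apply: (H Ay); exact: AB.
Qed.

Lemma within_continuousM {R : realType} {T : topologicalType} (A : set T)
    (f g : T -> R) : {within A, continuous f} -> {within A, continuous g} ->
  {within A, continuous (fun x => f x * g x)}.
Proof.
move=> /subspace_continuousP cf /subspace_continuousP cg.
by apply/subspace_continuousP => x Ax; apply: cvgM; [exact: cf|exact: cg].
Qed.

Lemma within_continuousZ {R : realType} {T : topologicalType} (A : set T)
    (f : T -> R) (c : R) : {within A, continuous f} ->
  {within A, continuous (fun x => c * f x)}.
Proof.
move=> /subspace_continuousP cf; apply/subspace_continuousP => x Ax.
by apply: cvgM; [exact: cvg_cst|exact: cf].
Qed.

(** * Differential calculus relative to a domain *)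

Section calculus.
Context {R : realType} {V : normedModType R}.
Implicit Types (D : set V) (f g : V -> R).

Lemma is_derive_withinP D f z v l :
  is_derive_within D f z v l <->
  forall e, 0 < e -> exists2 d, 0 < d & forall h, h != 0 -> `|h| < d ->
    D (h *: v + z) -> `|h^-1 * (f (h *: v + z) - f z) - l| <= e.
Proof.
rewrite /is_derive_within /quotient_within cvgrPdist_le; split=> H e e0.
- have := H e e0; rewrite near_withinE => -[d /= d0 dH].
  exists d => // h h0 hd Dh; rewrite distrC; apply: dH => //=.
  by rewrite sub0r normrN.
- have [d d0 dH] := H e e0; rewrite near_withinE.
  exists d => //= h; rewrite /ball_ /= sub0r normrN => hd h0 Dh.
  by rewrite distrC; apply: dH.
Qed.

(** One admissible increment [h0] yields, by shrinking, admissible increments arbitrarily close to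
    0. Limits of difference quotients are then unique, so that [lim] in [derive_within] returns the
    derivative. *)
Lemma proper_increments D z v h0 : convex_domain D -> D z -> h0 != 0 ->
  D (h0 *: v + z) -> ProperFilter (within [set h | D (h *: v + z)] (0 : R)^').
Proof.
move=> cD Dz h00 Dh; apply: Build_ProperFilter_ex => P.
rewrite /within /= => -[d /= d0 dP].
have n0 : 0 < `|h0| by rewrite normr_gt0.
(* The factor must stay in [0, 1] for convexity, and it brings [h0] down to norm at most [d / 2]. *)
pose s : R := Num.min 1 (d / (2 * `|h0|)).
have s0 : 0 < s by rewrite lt_min ltr01 divr_gt0 // mulr_gt0.
have s1 : s <= 1 by rewrite ge_min lexx.
have sd : s * `|h0| < d.
  have : s <= d / (2 * `|h0|) by rewrite ge_min lexx orbT.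
  by rewrite ler_pdivlMr ?mulr_gt0 //; nra.
exists (s * h0); apply: dP => /=.
- by rewrite sub0r normrN normrM gtr0_norm.
- by rewrite mulf_neq0 // gt_eqF.
- by apply: cD => //; rewrite ltW.
Qed.

Lemma derive_withinE D f z v l h0 : convex_domain D -> D z -> h0 != 0 ->
  D (h0 *: v + z) -> is_derive_within D f z v l -> derive_within D f z v = l.
Proof.
move=> cD Dz h00 Dh H; have PF := proper_increments cD Dz h00 Dh.
exact: (@cvg_lim _ (@Rhausdorff R) _ _ _ _ _ H).
Qed.

Lemma eq_is_derive_within D f g z v l : D z -> {in D, f =1 g} ->
  is_derive_within D f z v l -> is_derive_within D g z v l.
Proof.
move=> Dz fg /is_derive_withinP H; apply/is_derive_withinP => e /H[d d0 dH].
by exists d => // h h0 hd Dh; rewrite -!fg ?inE //; apply: dH.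
Qed.

(** The value at the displaced point is [f z] plus [h] times a convergent quotient. This gives
    continuity along [v] only, which is all the product rule requires. *)
Lemma is_derive_within_cvg D f z v l : is_derive_within D f z v l ->
  f (h *: v + z) @[h --> within [set h : R | D (h *: v + z)] 0^'] --> f z.
Proof.
move=> H.
have H1 : (f z + h * (h^-1 * (f (h *: v + z) - f z)))
     @[h --> within [set h : R | D (h *: v + z)] 0^'] --> f z + 0 * l.
  apply: (@cvgD _ _ _ _ _ (fun=> f z)); first exact: cvg_cst.
  apply: (@cvgM _ _ _ _ id) => // U [d /= d0 dU]; exists d => //= h hd _ _; exact: dU.
rewrite mul0r addr0 in H1; apply: cvg_trans H1; apply: near_eq_cvg.
rewrite near_withinE; exists 1 => //= h _ h0 _.
by rewrite mulrA mulfV // mul1r addrC subrK.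
Qed.

Lemma is_derive_withinD D f g z v l m : is_derive_within D f z v l ->
  is_derive_within D g z v m ->
  is_derive_within D (fun x => f x + g x) z v (l + m).
Proof.
move=> Hf Hg; apply: cvg_trans (cvgD Hf Hg); apply: near_eq_cvg.
by apply: nearW => h /=; rewrite ?fctE /=; ring.
Qed.

Lemma is_derive_within_cst D z v c : is_derive_within D (fun=> c) z v 0.
Proof.
have : (0 : R) @[h --> within [set h : R | D (h *: v + z)] 0^'] --> (0 : R).
  exact: cvg_cst.
move=> H; apply: cvg_trans H; apply: near_eq_cvg.
by apply: nearW => h /=; rewrite subrr mulr0.
Qed.

Lemma is_derive_withinM D f g z v l m : is_derive_within D f z v l ->
  is_derive_within D g z v m ->
  is_derive_within D (fun x => f x * g x) z v (l * g z + f z * m).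
Proof.
move=> Hf Hg; have Hc := is_derive_within_cvg Hf.
apply: cvg_trans (cvgD (cvgM Hf (cvg_cst (g z))) (cvgM Hc Hg)); apply: near_eq_cvg.
by apply: nearW => h /=; rewrite ?fctE /=; ring.
Qed.

Lemma is_derive_withinZ D f z v l c : is_derive_within D f z v l ->
  is_derive_within D (fun x => c * f x) z v (c * l).
Proof.
move=> H; have := is_derive_withinM (is_derive_within_cst D z v c) H.
by rewrite mul0r add0r.
Qed.

Lemma is_derive_withinB D f g z v l m : is_derive_within D f z v l ->
  is_derive_within D g z v m ->
  is_derive_within D (fun x => f x - g x) z v (l - m).
Proof.
move=> Hf Hg; have H := is_derive_withinD Hf (is_derive_withinZ (c := -1) Hg).
rewrite mulN1r in H; apply: cvg_trans H; apply: near_eq_cvg.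
by apply: nearW => h /=; rewrite !mulN1r.
Qed.

(** On the segment from [z] to [h *: v + z] this is the classical mean value theorem for a function
    of one parameter in [0, 1]. The segment may lie in the boundary of [D], since derivatives are
    taken only along it. *)
Lemma MVT_within D f g z v h : convex_domain D -> {within D, continuous f} ->
  (forall x, D x -> is_derive_within D f x v (g x)) ->
  D z -> D (h *: v + z) ->
  exists2 s, 0 <= s <= 1 &
    f (h *: v + z) - f z = h * g ((s * h) *: v + z).
Proof.
move=> cD cf df Dz Dh.
have [->|h0] := eqVneq h 0.
  by exists 0; rewrite ?lexx ?ler01 // scale0r add0r subrr mul0r.
pose phi (s : R) := f ((s * h) *: v + z).
have Dphi (s : R) : 0 <= s <= 1 -> D ((s * h) *: v + z) by move=> ?; exact: cD.
(* At an interior parameter all small increments of either sign stay on the segment, so the relative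
   derivative becomes an ordinary two-sided one. *)
have dphi (s : R) : s \in `]0, 1[ ->
    is_derive s 1 phi (h * g ((s * h) *: v + z)).
  rewrite in_itv /= => /andP[s0 s1].
  have Ds : D ((s * h) *: v + z) by apply: Dphi; rewrite !ltW.
  have H : (fun k : R => k^-1 *: ((phi \o shift s) (k *: 1) - phi s)) @ 0^'
      --> h * g ((s * h) *: v + z).
    apply/cvgrPdist_le => e e0.
    have n0 : 0 < `|h| by rewrite normr_gt0.
    have /is_derive_withinP/(_ (e / `|h|)) := df _ Ds.
    case; [by rewrite divr_gt0|move=> d d0 dH].
    near=> k.
    have k0 : k != 0 by near: k; exact: nbhs_dnbhs_neq.
    have kh0 : k * h != 0 by rewrite mulf_neq0.
    have E : (k * h) *: v + ((s * h) *: v + z) = ((k + s) * h) *: v + z.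
      by rewrite addrA -scalerDl -mulrDl.
    have := dH (k * h) kh0; rewrite E => /(_ _ _)/wrap[].
    - rewrite normrM -ltr_pdivlMr //; near: k.
      apply: dnbhs0_lt; exact: divr_gt0.
    - apply: Dphi; apply/andP; split.
      + have : `|k| < s by near: k; exact: dnbhs0_lt.
        by rewrite ltr_norml; lra.
      + have : `|k| < 1 - s by near: k; apply: dnbhs0_lt; rewrite subr_gt0.
        by rewrite ltr_norml; lra.
    rewrite /phi /= [k *: 1]mulr1 -normrN opprB.
    set A := f _ - f _; set B := g _ => HH.
    have -> : k^-1 *: A - h * B = h * ((k * h)^-1 * A - B).
      by rewrite /GRing.scale /=; field; rewrite h0 k0.
    by rewrite normrM mulrC -ler_pdivlMr.
  split; first by apply/cvg_ex; eexists; exact: H.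
  exact: (@cvg_lim _ (@Rhausdorff R) _ _ _ _ _ H).
have cphi : {within `[0, 1], continuous phi}.
  apply: (within_continuousT_comp (f := fun s : R => (s * h) *: v + z)) cf.
    by move=> s /=; rewrite in_itv /=; exact: Dphi.
  apply: continuous_subspaceT => s; apply: cvgD; last exact: cvg_cst.
  by apply: cvgZr_tmp; apply: cvgM; [exact: cvg_id | exact: cvg_cst].
have [c c01] := MVT_segment (@ler01 R) dphi cphi.
rewrite /phi mul1r mul0r scale0r add0r subr0 mulr1 => E.
by exists c => //; rewrite in_itv in c01.
Unshelve. all: by end_near.
Qed.

End calculus.

(** * Slices of a product domain and exchange of derivatives *)

Section product_domain.
Context {R : realType} {V : normedModType R}.
Variables (D : set V) (L : set R).
Implicit Types F : V * R -> R.

Lemma is_derive_within_slicel F z a v l : L a ->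
  is_derive_within (D `*` L) F (z, a) (v, 0) l ->
  is_derive_within D (fun x => F (x, a)) z v l.
Proof.
move=> La /is_derive_withinP H; apply/is_derive_withinP => e /H[d d0 dH].
exists d => // h h0 hd Dh; have := dH h h0 hd.
have -> : h *: (v, 0 : R) + (z, a) = (h *: v + z, a).
  by apply/pair_equal_spec; split=> //=; rewrite [h *: _]mulr0 add0r.
exact.
Qed.

Lemma is_derive_within_slicer F z a b l : D z ->
  is_derive_within (D `*` L) F (z, a) (0, b) l ->
  is_derive_within L (fun s => F (z, s)) a b l.
Proof.
move=> Dz /is_derive_withinP H; apply/is_derive_withinP => e /H[d d0 dH].
exists d => // h h0 hd Dh; have := dH h h0 hd.
have -> : h *: (0 : V, b) + (z, a) = (z, h *: b + a).
  by apply/pair_equal_spec; split=> //=; rewrite scaler0 add0r.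
exact.
Qed.

Lemma within_continuous_slicel F a : L a -> {within D `*` L, continuous F} ->
  {within D, continuous (fun x => F (x, a))}.
Proof.
move=> La; apply: (@within_continuousT_comp _ _ _ _ _ (fun x => (x, a))) => //.
by apply: continuous_subspaceT => x; 
  exact: (cvg_pair (G := nbhs x) (H := nbhs a) cvg_id (cvg_cst a)).
Qed.

Lemma within_continuous_slicer F z : D z -> {within D `*` L, continuous F} ->
  {within L, continuous (fun s => F (z, s))}.
Proof.
move=> Dz; apply: (@within_continuousT_comp _ _ _ _ _ (fun s => (z, s))) => //.
by apply: continuous_subspaceT => x; 
  exact: (cvg_pair (G := nbhs z) (H := nbhs x) (cvg_cst z) cvg_id).
Qed.

(* The second difference of F over a parallelogram is the product of the two
   increments with a value of g', by the mean value theorem used twice; unlike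
   Schwarz's theorem this also covers boundary points. *)
Lemma is_derive_within_exchange F g g' G v z a k0 :
  convex_domain D -> convex_domain L ->
  {within D `*` L, continuous F} -> {within D `*` L, continuous g} ->
  {within D `*` L, continuous g'} ->
  (forall w, (D `*` L) w -> is_derive_within (D `*` L) F w (v, 0) (g w)) ->
  (forall w, (D `*` L) w -> is_derive_within (D `*` L) g w (0, 1) (g' w)) ->
  (forall w, (D `*` L) w -> is_derive_within (D `*` L) F w (0, 1) (G w)) ->
  D z -> L a -> k0 != 0 -> L (k0 + a) ->
  is_derive_within D (fun x => G (x, a)) z v (g' (z, a)).
Proof.
move=> cD cL cF cg cg' dF dg dG Dz La k00 Lk0.
apply/is_derive_withinP => e e0.
have /subspace_continuousP/(_ (z, a))/(_ (conj Dz La)) := cg'.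
move/cvgrPdist_le => /(_ e e0); rewrite near_withinE.
move=> -[[A B] /= [] /nbhs_ballP[d1 /= d10 A1] /nbhs_ballP[d2 /= d20 B1] AB].
(* Adding 1 keeps the denominator below positive even when [v] is zero. *)
have v0 : 0 < `|v| + 1 by rewrite ltr_wpDl.
exists (d1 / (`|v| + 1)); first exact: divr_gt0.
move=> h h0 hd Dh.
(* The increment [k0] ensures that admissible [k] accumulate at 0; otherwise no bound could be
   passed to the limit in [k]. *)
have PF : ProperFilter (within [set k | L (k *: 1 + a)] (0 : R)^').
  by apply: (proper_increments (h0 := k0)) => //; rewrite [k0 *: 1]mulr1.
have dG' x : D x ->
    k^-1 * (F (x, k *: 1 + a) - F (x, a)) @[k --> within [set k | L (k *: 1 + a)] 0^'] --> G (x, a).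
  by move=> Dx; apply: (is_derive_within_slicer (F := F) (b := 1)) => //; exact: dG.
(* With [h] fixed, the norm of [Q k] tends to the quantity to be estimated, so it suffices to bound
   [Q k] for all small [k]. *)
pose Q k := h^-1 * (k^-1 * (F (h *: v + z, k *: 1 + a) - F (h *: v + z, a)) -
  k^-1 * (F (z, k *: 1 + a) - F (z, a))) - g' (z, a).
have cQ : `|Q k| @[k --> within [set k | L (k *: 1 + a)] 0^'] -->
    `|h^-1 * (G (h *: v + z, a) - G (z, a)) - g' (z, a)|.
  apply: cvg_norm; apply: cvgB; last exact: cvg_cst.
  apply: cvgM; first exact: cvg_cst.
  by apply: cvgB; exact: dG'.
apply: cvgr_to_le cQ _; rewrite near_withinE.
exists d2 => //= k; rewrite /ball_ /= sub0r normrN => kd k_neq0 Lk.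
pose psi x := F (x, k *: 1 + a) - F (x, a).
have cpsi : {within D, continuous psi}.
  by apply: within_continuousB; exact: within_continuous_slicel.
have dpsi x : D x -> is_derive_within D psi x v (g (x, k *: 1 + a) - g (x, a)).
  by move=> Dx; apply: is_derive_withinB; apply: is_derive_within_slicel => //; exact: dF.
have [s s01 Es] := MVT_within cD cpsi dpsi Dz Dh.
set y := (s * h) *: v + z in Es.
have Dy : D y by exact: cD.
have cgy : {within L, continuous (fun t => g (y, t))} by exact: within_continuous_slicer.
have dgy t : L t -> is_derive_within L (fun t => g (y, t)) t 1 (g' (y, t)).
  by move=> Lt; apply: is_derive_within_slicer => //; exact: dg.
have [t t01 Et] := MVT_within cL cgy dgy La Lk.
have -> : Q k = g' (y, (t * k) *: 1 + a) - g' (z, a).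
  rewrite /Q -mulrBr; rewrite /psi in Es; rewrite Es Et.
  by field; rewrite h0 k_neq0.
(* The intermediate point is at most [h *: v] and [k] away from [(z, a)], inside the neighbourhood
   given by the continuity of [g']. *)
rewrite distrC; apply: (AB (y, _)); last by split => //; exact: cL.
have norm_le (c r : R) : 0 <= c <= 1 -> `|c * r| <= `|r|.
  by move=> /andP[c0 c1]; rewrite normrM ger0_norm // ler_piMl.
split; [apply: A1|apply: B1].
- rewrite -ball_normE /ball_ /= /y -normrN opprB addrK normrZ.
  apply: le_lt_trans (_ : `|h| * (`|v| + 1) < _); last by rewrite -ltr_pdivlMr.
  by apply: ler_pM => //; [exact: norm_le|rewrite lerDl].
- rewrite /ball /= -normrN opprB addrK [_ *: 1]mulr1.
  by apply: le_lt_trans kd; exact: norm_le.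
Qed.

End product_domain.

(** * The chain rule along coordinate axes *)

Section chain.
Context {R : realType} {V : normedModType R}.

(** This treats one leg of a broken path whose base point [x h] moves with [h]. By the mean value
    theorem the increment of [K] is [b h] times a value of [g] on the leg, and the leg shrinks to
    [p], where [g] is continuous. *)
Lemma increment_quotient_cvg (K g : V -> R) (u p : V) (F : set_system R)
    (x : R -> V) (b : R -> R) (c : R) : Filter F ->
  {within setT, continuous K} -> {for p, continuous g} ->
  (forall y, is_derive_within setT K y u (g y)) ->
  x h @[h --> F] --> p -> b h @[h --> F] --> 0 -> h^-1 * b h @[h --> F] --> c ->
  h^-1 * (K (b h *: u + x h) - K (x h)) @[h --> F] --> c * g p.
Proof.
move=> FF cK cg dK xp b0 bc.
have /choice[s sP] h : exists s : R, 0 <= s <= 1 /\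
    K (b h *: u + x h) - K (x h) = b h * g ((s * b h) *: u + x h).
  have cT : convex_domain (setT : set V) by [].
  have [s s01 E] := MVT_within cT cK (fun y _ => dK y) (Logic.I : setT (x h))
    (Logic.I : setT (b h *: u + x h)).
  by exists s.
have H : h^-1 * b h * g ((s h * b h) *: u + x h) @[h --> F] --> c * g p.
  apply: cvgM => //; apply: continuous_cvg => //.
  rewrite -[X in _ --> X]add0r -[X in X + _](scale0r u).
  apply: cvgD => //; apply: cvgZr_tmp.
  apply/cvgrPdist_le => e e0; have /cvgrPdist_le/(_ e e0) := b0.
  apply: filterS => h; rewrite !sub0r !normrN; apply: le_trans.
  by have [/andP[s0 s1] _] := sP h; rewrite normrM ger0_norm // ler_piMl.
apply: cvg_trans H; apply: near_eq_cvg; apply: nearW => h.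
by have [_ ->] := sP h; rewrite mulrA.
Qed.

End chain.

Lemma ord2_eq (i : 'I_2) : i = 0 \/ i = 1.
Proof. by case: i => [[|[|//]]] Hi; [left|right]; exact: val_inj. Qed.

Section chain_rule.
Context {R : realType} {V : normedModType R}.

(** The path from [q z] to [q (h *: v + z)] is replaced by three legs, changing first the value of
    [f], then [w 0], then [w 1]. Continuous derivatives of [K] along the axes thus suffice, without
    a total differential. *)
Lemma is_derive_within_chain (D : set V) (K g0 g1 g2 : R * 'rV[R]_2 -> R)
    (f : V -> R) (w : 'I_2 -> V -> R) (z v : V) (l : R) (m : 'I_2 -> R) :
  {within setT, continuous K} -> {within setT, continuous g0} ->
  {within setT, continuous g1} -> {within setT, continuous g2} ->
  (forall y, is_derive_within setT K y (1, 0) (g0 y)) ->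
  (forall y, is_derive_within setT K y (0, e 0) (g1 y)) ->
  (forall y, is_derive_within setT K y (0, e 1) (g2 y)) ->
  is_derive_within D f z v l ->
  (forall mu, is_derive_within D (w mu) z v (m mu)) ->
  let q x := (f x, \row_mu w mu x) in
  is_derive_within D (K \o q) z v
    (m 1 * g2 (q z) + (m 0 * g1 (q z) + l * g0 (q z))).
Proof.
move=> cK c0 c1 c2 d0 d1 d2 df dw q.
pose F := within [set h : R | D (h *: v + z)] (0 : R)^'.
have FF : Filter F by exact: within_filter.
have cT (g : R * 'rV[R]_2 -> R) : {within setT, continuous g} -> {for q z, continuous g}.
  move=> /subspace_continuousP cg P HP.
  have H : nbhs (q z) (fun y => True -> P (g y)) := cg (q z) Logic.I P HP.
  by apply: filterS H => y; exact.
have delta0 g n : is_derive_within D g z v n -> g (h *: v + z) - g z @[h --> F] --> 0.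
  move=> dg; rewrite -[X in _ --> X](subrr (g z)).
  by apply: cvgB; [exact: is_derive_within_cvg dg|exact: cvg_cst].
pose b0 h := f (h *: v + z) - f z.
pose b mu h := w mu (h *: v + z) - w mu z.
(* [x1 h] and [x2 h] are the two corners of the broken path; both converge to [q z]. *)
pose x1 h := b0 h *: (1, 0 : 'rV[R]_2) + q z.
pose x2 h := b 0 h *: (0 : R, e 0) + x1 h.
have cx1 : x1 h @[h --> F] --> q z.
  rewrite -[X in _ --> X]add0r -[X in X + _](scale0r (1 : R, 0 : 'rV[R]_2)).
  by apply: cvgD; [apply: cvgZr_tmp; exact: delta0 df|exact: cvg_cst].
have cx2 : x2 h @[h --> F] --> q z.
  rewrite -[X in _ --> X]add0r -[X in X + _](scale0r (0 : R, e 0)).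
  by apply: cvgD => //; apply: cvgZr_tmp; exact: delta0 (dw 0).
have cx0 : q z @[h --> F] --> q z by exact: cvg_cst.
have H0 := increment_quotient_cvg FF cK (cT _ c0) d0 cx0 (delta0 _ _ df) df.
have H1 := increment_quotient_cvg FF cK (cT _ c1) d1 cx1 (delta0 _ _ (dw 0)) (dw 0).
have H2 := increment_quotient_cvg FF cK (cT _ c2) d2 cx2 (delta0 _ _ (dw 1)) (dw 1).
have E : (fun h : R => h^-1 * ((K \o q) (h *: v + z) - (K \o q) z)) =
    (fun h => h^-1 * (K (b 1 h *: (0 : R, e 1) + x2 h) - K (x2 h))) +
    ((fun h => h^-1 * (K (b 0 h *: (0 : R, e 0) + x1 h) - K (x1 h))) +
     (fun h => h^-1 * (K (b0 h *: (1, 0 : 'rV[R]_2) + q z) - K (q z)))).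
  apply/funext => h; rewrite !fctE -!mulrDr; congr (_ * _).
  have -> : b 1 h *: (0 : R, e 1) + x2 h = q (h *: v + z).
    rewrite /x2 /x1 /b /b0 /q; apply/pair_equal_spec; split => /=.
      by rewrite [_ *: 0]mulr0 [_ *: 0]mulr0 [_ *: 1]mulr1 !add0r subrK.
    apply/rowP => i; rewrite !mxE /= mulr0 add0r.
    by have [->|->] := ord2_eq i; rewrite /= ?(mulr0, mulr1, add0r) subrK.
  by rewrite -/(x2 h) -/(x1 h) /=; ring.
by rewrite /is_derive_within /quotient_within E; exact: cvgD H2 (cvgD H1 H0).
Qed.

End chain_rule.

(** * Measurability and integrability of continuous functions in the plane *)

Section plane_measure.
Context {R : realType}.
Local Notation T2 := (measurableTypeR R * measurableTypeR R)%type.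
Local Notation mu2 := (lebesgue_measure \x lebesgue_measure)%E.

(** An open set is a countable union of open squares with rational centre and radius, each
    measurable as a product of intervals. *)
Lemma open_measurable_plane (U : set (R * R)) : open U -> measurable (U : set T2).
Proof.
move=> oU.
pose I (q s : rat) : set R := [set` `]ratr q - ratr s, ratr q + ratr s[].
have -> : U = \bigcup_q \bigcup_r \bigcup_s
    (if `[< I q s `*` I r s `<=` U >] then I q s `*` I r s else set0).
  apply/seteqP; split=> [[t x] Utx|[t x] [q _ [r _ [s _]]]]; last first.
    by case: ifPn => // /asboolP; exact.
  have /nbhs_ballP[d /= d0 dU] : nbhs (t, x) U by exact: open_nbhs_nbhs.
  (* The centre is chosen within [s] of the point, and the square extends [s] further; a radius
     below [d / 2] keeps it in the ball of radius [d]. *)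
  have [|s] := @rat_in_itvoo R (d / 4) (d / 2); first lra.
  rewrite in_itv /= => /andP[s1 s2].
  have [|q] := @rat_in_itvoo R (t - ratr s) (t + ratr s); first lra.
  rewrite in_itv /= => /andP[q1 q2].
  have [|r] := @rat_in_itvoo R (x - ratr s) (x + ratr s); first lra.
  rewrite in_itv /= => /andP[r1 r2].
  exists q => //; exists r => //; exists s => //; rewrite ifT.
    by split; rewrite /I /= in_itv /=; apply/andP; split; lra.
  apply/asboolP => -[t' x'] []; rewrite /I /= !in_itv /= => /andP[h1 h2] /andP[h3 h4].
  by apply: dU; split; rewrite /ball /= ltr_norml; apply/andP; split; lra.
do 3!(apply: bigcupT_measurable_rat => ?).
by case: ifPn => // _; apply: measurableX; exact: measurable_itv.
Qed.

Lemma within_continuous_measurable_plane (A : set (R * R)) (f : R * R -> R) :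
  measurable (A : set T2) -> {within A, continuous f} ->
  measurable_fun (A : set T2) (f : T2 -> R).
Proof.
move=> mA /continuousP cf; apply: (measurability _ (measurable_realfun.RGenOpens.measurableE R)).
move=> _ [_ [a [b ->] <-]].
have oU : open ((f : subspace A -> R) @^-1` `]a, b[) by exact/cf/interval_open.
move/open_subspaceP : oU => [V oV VD].
by rewrite setIC -VD; apply: measurableI => //; exact: open_measurable_plane.
Qed.

(** A compact rectangle has finite measure, and a continuous function on it is bounded. *)
Lemma rectangle_integrable (s t b c : R) (f : R * R -> R) :
  {within `[s, t] `*` `[b, c], continuous f} ->
  mu2.-integrable (`[s, t] `*` `[b, c] : set T2) (EFin \o f).
Proof.
move=> cf.
have mA : measurable (`[s, t] `*` `[b, c] : set T2).
  by apply: measurableX; exact: measurable_itv.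
apply: measurable_bounded_integrable => //.
- have E : (mu2 (`[s, t] `*` `[b, c]) =
      lebesgue_measure (`[s, t]%classic : set R) * lebesgue_measure (`[b, c]%classic : set R))%E.
    by apply: product_measure1E; exact: measurable_itv.
  have fin (x y : R) : (lebesgue_measure (`[x, y]%classic : set R) < +oo)%E.
    by rewrite lebesgue_measure_itv /=; case: ifP => // _; rewrite -EFinB ltry.
  by rewrite [X in (X < _)%E]E; apply: lte_mul_pinfty; rewrite ?ge0_fin_numE.
- exact: within_continuous_measurable_plane.
- have cA : compact (`[s, t] `*` `[b, c] : set (R * R)).
    by apply: compact_setX; exact: segment_compact.
  have /compact_bounded[M [_ mrt]] := continuous_compact cf cA.
  by exists M; split; rewrite ?num_real // => ? ? ? ?; exact: mrt.
Qed.

End plane_measure.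

(** * Integrals over space-time slabs *)

Section slab.
Context {R : realType}.
Local Notation T2 := (measurableTypeR R * measurableTypeR R)%type.
Local Notation mu2 := (lebesgue_measure \x lebesgue_measure)%E.
Variables (a1 a2 : R).
Local Notation D := (spacetime a1 a2).

Lemma event0 (t x : R) : event t x 0 0 = t.
Proof. by rewrite /event /e !mxE /= mulr1 mulr0 addr0. Qed.

Lemma event1 (t x : R) : event t x 0 1 = x.
Proof. by rewrite /event /e !mxE /= mulr1 mulr0 add0r. Qed.

Lemma eventE (z : 'rV[R]_2) : event (z 0 0) (z 0 1) = z.
Proof.
by apply/rowP => i; have [->|->] := ord2_eq i; rewrite (event0, event1).
Qed.

Lemma spacetime_event (t x : R) : 0 <= t -> a1 < x < a2 -> D (event t x).
Proof. by move=> t0 x0; rewrite /spacetime /= event0 event1. Qed.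

Lemma event_continuous : continuous (fun p : R * R => event p.1 p.2).
Proof.
move=> p; rewrite /event; apply: cvgD; apply: cvgZr_tmp; [exact: cvg_fst|exact: cvg_snd].
Qed.

(** The strict inequalities keep the closed rectangle inside the domain. Over the whole open body a
    continuous [f] may blow up at the ends. *)
Lemma slab_integrable (s t b c : R) (f : 'rV[R]_2 -> R) :
  0 <= s -> a1 < b -> c < a2 -> {within D, continuous f} ->
  mu2.-integrable (`[s, t] `*` `[b, c] : set T2)
    (EFin \o (fun p => f (event p.1 p.2))).
Proof.
move=> s0 ab ca cf.
apply: (rectangle_integrable (f := fun p => f (event p.1 p.2))).
apply: (within_continuousT_comp (f := fun p : R * R => event p.1 p.2)) cf; last first.
  by apply: continuous_subspaceT; exact: event_continuous.
move=> [u x] []; rewrite /= !in_itv /= => /andP[u0 _] /andP[bx xc].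
apply: spacetime_event; first exact: le_trans u0.
by rewrite (lt_le_trans ab) // (le_lt_trans xc).
Qed.

(** All slabs in the invariance start at time 0; subtracting two of them isolates a box that can be
    made small around any chosen event. *)
Lemma slab_integralB (s t b c : R) (f : 'rV[R]_2 -> R) :
  0 <= s -> s < t -> a1 < b -> c < a2 -> {within D, continuous f} ->
  slab_integral t b c f - slab_integral s b c f =
  (\int[mu2]_(p in (`]s, t] `*` `]b, c[ : set T2)) f (event p.1 p.2))%R.
Proof.
move=> s0 st ab ca cf; rewrite /slab_integral.
have E : (`[0, t] `*` `]b, c[ : set T2) =
    (`[0, s] `*` `]b, c[) `|` (`]s, t] `*` `]b, c[).
  apply/seteqP; split => [[u x] []|[u x] [] []]; rewrite /= !in_itv /=.
  - move=> /andP[u0 ut] xbc; case: (leP u s) => us; [left|right];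
      by rewrite /= ?u0 ?ut.
  - by move=> /andP[u0 us] xbc; rewrite u0 (le_trans us) // ltW.
  - by move=> /andP[su ut] xbc; rewrite ut andbT (le_trans s0) // ltW.
rewrite E Rintegral_setU.
- by rewrite addrAC subrr add0r.
- by apply: measurableX; exact: measurable_itv.
- by apply: measurableX; exact: measurable_itv.
- rewrite -E; apply: integrableS (slab_integrable t (lexx 0) ab ca cf).
  + by apply: measurableX; exact: measurable_itv.
  + by apply: measurableX; exact: measurable_itv.
  + by apply: setSX => // x /=; rewrite !in_itv /= => /andP[/ltW -> /ltW ->].
- apply/disj_setPS => -[u x] [[/= + _] [/= + _]].
  by rewrite !in_itv /= => /andP[_ us] /andP[su _]; rewrite ltNge us in su.
Qed.

End slab.

(** * From the integral identity to a pointwise one *)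

Section localization.
Context {R : realType}.
Local Notation T2 := (measurableTypeR R * measurableTypeR R)%type.
Local Notation mu2 := (lebesgue_measure \x lebesgue_measure)%E.
Variables (a1 a2 : R).
Local Notation D := (spacetime a1 a2).
Local Notation L := (`[0%R, +oo[%classic : set R).

Lemma convex_spacetime : convex_domain D.
Proof.
move=> z v h s [z0 /andP[z1 z2]] [] + /andP[] + + /andP[s0 s1].
rewrite !mxE => v0 v1 v2.
have E mu : ((s * h) *: v + z) 0 mu = s * (h * v 0 mu + z 0 mu) + (1 - s) * z 0 mu.
  by rewrite !mxE; ring.
rewrite /spacetime /= !E; move: s0; rewrite le_eqVlt => /predU1P[<-|s0].
  by rewrite !mul0r !add0r !subr0 !mul1r; split => //; rewrite z1.
by split; [nra|apply/andP; split; nra].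
Qed.

Lemma convex_halfline : convex_domain L.
Proof.
move=> z v h s /=; rewrite !in_itv /= !andbT => z0 hv /andP[s0 s1].
by have -> : (s * h) *: v + z = s * (h *: v + z) + (1 - s) * z;
  [rewrite /GRing.scale /=; ring|rewrite addr_ge0 // mulr_ge0 // subr_ge0].
Qed.

Lemma box_measure (s t b c : R) : s < t -> b < c ->
  mu2 (`]s, t] `*` `]b, c[ : set T2) = ((t - s) * (c - b))%:E.
Proof.
move=> st bc.
have -> : (mu2 (`]s, t] `*` `]b, c[) =
    lebesgue_measure (`]s, t]%classic : set R) * lebesgue_measure (`]b, c[%classic : set R))%E.
  by apply: product_measure1E; exact: measurable_itv.
by rewrite !lebesgue_measure_itv /= !lte_fin st bc -!EFinB -EFinM.
Qed.

(** No differentiation under the integral sign takes place. On a small box the integrand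
    [q z - k z], with [q] the quotient of [S] in lambda, is within [e] of [W], while the identity
    bounds its integral by [e] times the area; hence [W] is at most [2 * e] in norm. *)
Lemma localization (S T : R -> 'rV[R]_2 -> R) (k : 'rV[R]_2 -> R) :
  {within D `*` L, continuous (fun w => S w.2 w.1)} ->
  {within D `*` L, continuous (fun w => T w.2 w.1)} ->
  {within D, continuous k} ->
  (forall z lam, D z -> L lam ->
     is_derive_within L (fun s => S s z) lam 1 (T lam z)) ->
  (forall tau b1 b2 : R, 0 < tau -> a1 <= b1 -> b1 < b2 -> b2 <= a2 ->
    is_derive_within L (fun lam => slab_integral tau b1 b2 (S lam)) 0 1
      (slab_integral tau b1 b2 k)) ->
  forall z, D z -> T 0 z = k z.
Proof.
move=> cS cT ck dS dint z0 Dz0.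
have L0 : L 0 by rewrite /= in_itv /= lexx.
pose W := T 0 z0 - k z0.
suff H e : 0 < e -> `|W| <= 2 * e.
  apply/eqP; rewrite -subr_eq0 -normr_le0; apply/ler_addgt0Pr => e e0.
  by rewrite add0r; have := H (e / 2); rewrite divr_gt0 // => /(_ isT); rewrite mulrC divfK.
move=> e0.
(* Half of [e] is spent on [T], jointly in the event and lambda, and half on [k]. *)
have [d d0 dP] : exists2 d, 0 < d & forall t x lam, `|z0 0 0 - t| < d ->
    `|z0 0 1 - x| < d -> 0 <= t -> a1 < x < a2 -> 0 <= lam < d ->
    `|T lam (event t x) - k (event t x) - W| <= e.
  have e2 : 0 < e / 2 by exact: divr_gt0.
  move/subspace_continuousP : cT => /(_ (z0, 0) (conj Dz0 L0)).
  move/cvgrPdist_le => /(_ _ e2); rewrite near_withinE => -[[A B] /= [nA]].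
  move=> /nbhs_ballP[dB /= dB0 dBP] AB.
  move/subspace_continuousP : ck => /(_ z0 Dz0).
  move/cvgrPdist_le => /(_ _ e2); rewrite near_withinE => nk.
  have nAk : nbhs (event (z0 0 0, z0 0 1).1 (z0 0 0, z0 0 1).2)
     (A `&` (fun z => D z -> `|k z0 - k z| <= e / 2)).
    by rewrite /= eventE; exact: filterI.
  have /nbhs_ballP[d1 /= d10 d1P] := event_continuous nAk.
  exists (Num.min d1 dB); first by rewrite lt_min d10.
  move=> t x lam; rewrite !lt_min => /andP[ht _] /andP[hx _] t0 ax.
  move=> /andP[l0] /andP[_ hl].
  have Dz : D (event t x) by exact: spacetime_event.
  have [Az kz] : (A `&` (fun z => D z -> `|k z0 - k z| <= e / 2)) (event t x).
    by apply: (d1P (t, x)).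
  have Tz : `|T 0 z0 - T lam (event t x)| <= e / 2.
    apply: (AB (event t x, lam)); last by split => //=; rewrite in_itv /= l0.
    by split => //; apply: dBP; rewrite /ball /= sub0r normrN ger0_norm.
  move: (kz Dz) Tz; rewrite /= !ler_norml /W => /andP[? ?] /andP[? ?].
  by apply/andP; split; lra.
have [z00 /andP[z01 z02]] := Dz0.
(* The first bound keeps the box within [d] of [z0]; the other two keep its closure strictly inside
   the body. *)
pose eta := Num.min (d / 2) (Num.min ((z0 0 1 - a1) / 2) ((a2 - z0 0 1) / 2)).
have eta0 : 0 < eta by rewrite !lt_min !divr_gt0 // subr_gt0.
have eta1 : eta <= d / 2 by rewrite ge_min lexx.
have eta2 : eta <= (z0 0 1 - a1) / 2 by rewrite !ge_min lexx orbT.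
have eta3 : eta <= (a2 - z0 0 1) / 2 by rewrite !ge_min lexx !orbT.
clearbody eta.
pose b1 := z0 0 1 - eta; pose b2 := z0 0 1 + eta.
(* The box begins strictly after time 0 even if [z0] lies on the initial line, because the identity
   holds for positive [tau] only. It need not contain [z0], only be close to it. *)
pose s1 := z0 0 0 + eta / 2; pose s2 := z0 0 0 + eta.
have s10 : 0 < s1 by rewrite /s1; lra.
have s12 : s1 < s2 by rewrite /s1 /s2; lra.
have b12 : b1 < b2 by rewrite /b1 /b2; lra.
have ab1 : a1 < b1 by rewrite /b1; lra.
have ba2 : b2 < a2 by rewrite /b2; lra.
pose B : set T2 := `]s1, s2] `*` `]b1, b2[.
pose area := (s2 - s1) * (b2 - b1).
have area0 : 0 < area by rewrite mulr_gt0 // subr_gt0.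
have mB : measurable B by apply: measurableX; exact: measurable_itv.
have muB : mu2 B = area%:E by exact: box_measure.
pose J f := (\int[mu2]_(p in B) f (event p.1 p.2))%R.
have intB (f : 'rV[R]_2 -> R) : {within D, continuous f} ->
    mu2.-integrable B (EFin \o (fun p => f (event p.1 p.2))).
  move=> cf; apply: integrableS (slab_integrable s2 (ltW s10) ab1 ba2 cf) => //.
    by apply: measurableX; exact: measurable_itv.
  by apply: setSX => x /=; rewrite !in_itv /= => /andP[/ltW -> ]// /ltW ->.
have JB (f g : 'rV[R]_2 -> R) : {within D, continuous f} -> {within D, continuous g} ->
    J (fun z => f z - g z) = J f - J g.
  by move=> cf cg; rewrite /J RintegralB //; exact: intB.
have JZ (c : R) (f : 'rV[R]_2 -> R) : {within D, continuous f} -> J (fun z => c * f z) = c * J f.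
  by move=> cf; rewrite /J RintegralZl //; exact: intB.
have Jc c : J (fun=> c) = c * area by rewrite /J Rintegral_cst // [X in fine X]muB.
have slabB (f : 'rV[R]_2 -> R) : {within D, continuous f} ->
    slab_integral s2 b1 b2 f - slab_integral s1 b1 b2 f = J f.
  by move=> cf; exact: (slab_integralB (ltW s10) s12 ab1 ba2 cf).
have cSl lam : L lam -> {within D, continuous (S lam)}.
  by move=> Ll; exact: (within_continuous_slicel (F := fun w => S w.2 w.1) Ll cS).
have dJ : is_derive_within L (fun lam => slab_integral s2 b1 b2 (S lam) -
    slab_integral s1 b1 b2 (S lam)) 0 1 (J k).
  rewrite -slabB //; apply: is_derive_withinB; apply: dint => //; try exact: ltW.
  exact: lt_trans s12.
have /is_derive_withinP/(_ (e * area) (mulr_gt0 e0 area0)) := dJ.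
move=> [d' d'0 d'P].
pose h := Num.min (d / 2) (d' / 2).
have h0 : 0 < h by rewrite lt_min !divr_gt0.
have hd : h <= d / 2 by rewrite ge_min lexx.
have hd' : h <= d' / 2 by rewrite ge_min lexx orbT.
clearbody h.
have Lh : L h by rewrite /= in_itv /= ltW.
have := d'P h; rewrite gt_eqF // gtr0_norm // [h *: 1]mulr1 addr0.
move=> /(_ isT); have -> : h < d' by lra.
move=> /(_ isT Lh); rewrite !slabB; try exact: cSl.
pose q z := h^-1 * (S h z - S 0 z).
have cd : {within D, continuous (fun z => S h z - S 0 z)}.
  by apply: within_continuousB; exact: cSl.
have cq : {within D, continuous q} by exact: within_continuousZ.
have cqk : {within D, continuous (fun z => q z - k z)} by exact: within_continuousB.
have cc : {within D, continuous (fun=> W : R)}.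
  by apply/subspace_continuousP => z _; exact: cvg_cst.
have Jq : h^-1 * (J (S h) - J (S 0)) - J k - W * area = J (fun z => q z - k z - W).
  by rewrite (JB _ _ cqk cc) (JB _ _ cq ck) Jc (JZ _ _ cd) (JB _ _ (cSl _ Lh) (cSl _ L0)).
have cf : {within D, continuous (fun z => q z - k z - W)} by exact: within_continuousB.
have bound : `|J (fun z => q z - k z - W)| <= e * area.
  rewrite /J; apply: le_trans (le_normr_Rintegral mB (intB _ cf)) _.
  rewrite -[X in _ <= X](Jc e) /J; apply: le_Rintegral => //.
  - have cn : {within D, continuous (fun z => `|q z - k z - W|)}.
      move/subspace_continuousP : cf => cf; apply/subspace_continuousP => z Dz.
      by apply: cvg_norm; exact: cf.
    exact: intB cn.
  - by apply: (intB (fun=> e)); apply/subspace_continuousP => z _; exact: cvg_cst.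
  move=> [t x] []; rewrite /= !in_itv /= => /andP[t1 t2] /andP[x1 x2].
  have t0 : 0 <= t by rewrite ltW // (lt_trans s10).
  have ax : a1 < x < a2 by rewrite (lt_trans ab1 x1) (lt_trans x2 ba2).
  have Dz : D (event t x) by exact: spacetime_event.
  have cSz := within_continuous_slicer (F := fun w => S w.2 w.1) Dz cS.
  have dSz lam : L lam -> is_derive_within L (fun s => S s (event t x)) lam 1 (T lam (event t x)).
    exact: dS.
  have Lh1 : L (h *: 1 + 0) by rewrite [h *: 1]mulr1 addr0.
  (* At each event of the box the quotient equals [T] at the intermediate parameter [s * h], which
     is below [d]; the choice of [s] may depend on the event. *)
  have [s /andP[s0 s1'] E] := MVT_within convex_halfline cSz dSz L0 Lh1.
  rewrite [h *: 1]mulr1 [(s * h) *: 1]mulr1 !addr0 /= in E.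
  rewrite /q E mulrA mulVf ?gt_eqF // mul1r.
  apply: dP => //.
  - by rewrite ltr_norml; move: t1 t2; rewrite /s1 /s2 => t1 t2; apply/andP; split; lra.
  - by rewrite ltr_norml; move: x1 x2; rewrite /b1 /b2 => x1 x2; apply/andP; split; lra.
  - apply/andP; split; first by rewrite mulr_ge0 // ltW.
    by apply: (@le_lt_trans _ _ h); [rewrite ler_piMl // ltW|lra].
move: bound; rewrite -Jq; set X := _ - J k => XW X0.
rewrite -(ler_pM2r area0) -[X in _ * X](gtr0_norm area0) -normrM.
(* [X] is small by the identity and [X - W * area] by the pointwise estimate. *)
have -> : W * area = X - (X - W * area) by ring.
apply: le_trans (ler_normB _ _) _; rewrite ?(gtr0_norm area0).
have E : 2 * e * area = e * area + e * area by ring.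
by rewrite E lerD.
Qed.

End localization.

(** * The quadratic density and the partial derivatives of fields *)

Section fields.
Context {R : realType}.
Variables (a1 a2 rho0 c : R).
Local Notation D := (spacetime a1 a2).
Local Notation L := (`[0%R, +oo[%classic : set R).

(** These are the diagonal coefficients of the quadratic form of which [sigma] is one half. *)
Definition modulus (mu : 'I_2) : R := if mu == 0 then rho0 else - c.

Lemma sum2 (F : 'I_2 -> R) : \sum_(mu < 2) F mu = F 0 + F 1.
Proof.
rewrite big_ord_recl big_ord_recl big_ord0 addr0.
by congr (F _ + F _); exact: val_inj.
Qed.

(** Since [sigma] is quadratic, its quotient is exactly the derivative plus [h] times half the
    coefficient. *)
Lemma derive_sigma (p : 'rV[R]_2) (mu : 'I_2) :
  'D_(e mu) (sigma rho0 c) p = modulus mu * p 0 mu.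
Proof.
have H : (modulus mu * p 0 mu + h * (2^-1 * modulus mu)) @[h --> (0 : R)^'] -->
    modulus mu * p 0 mu + 0 * (2^-1 * modulus mu).
  apply: (@cvgD _ _ _ _ _ (fun=> _)); first exact: cvg_cst.
  apply: cvgM; last exact: cvg_cst.
  exact: (@cvg_within _ (nbhs (0 : R))).
rewrite mul0r addr0 in H.
apply: (@cvg_lim _ (@Rhausdorff R)); apply: cvg_trans H; apply: near_eq_cvg.
near=> h.
have h0 : h != 0 by near: h; exact: nbhs_dnbhs_neq.
rewrite /= /GRing.scale /= /sigma /modulus !mxE /=.
by have [->|->] := ord2_eq mu; rewrite /=; field.
Unshelve. all: by end_near.
Qed.

(** This supplies the increment that makes partial derivatives well defined at every event: forward
    in time, or halfway towards [a2] in space. *)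
Lemma spacetime_increment (mu : 'I_2) z : D z ->
  exists2 h : R, h != 0 & D (h *: e mu + z).
Proof.
move=> [z0 /andP[z1 z2]]; have [->|->] := ord2_eq mu.
- exists 1; first exact: oner_neq0.
  rewrite /spacetime /= !mxE /= !mulr1 mulr0 add0r z1 z2; split => //.
  by rewrite addr_ge0.
- exists ((a2 - z 0 1) / 2); first by rewrite gt_eqF // divr_gt0 // subr_gt0.
  rewrite /spacetime /= !mxE /= !mulr1 mulr0 add0r; split => //.
  by apply/andP; split; lra.
Qed.

Lemma partialE (mu : 'I_2) (f g : 'rV[R]_2 -> R) z l : D z ->
  {in D, f =1 g} -> is_derive_within D f z (e mu) l -> partial a1 a2 mu g z = l.
Proof.
move=> Dz fg df; have [h h0 Dh] := spacetime_increment mu Dz.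
apply: (derive_withinE (@convex_spacetime R a1 a2) Dz h0 Dh).
exact: (eq_is_derive_within Dz fg).
Qed.

Lemma generatorE (Il : R -> 'rV[R]_2 -> R) z l :
  is_derive_within L (fun lam => Il lam z) 0 1 l -> generator Il z = l.
Proof.
apply: (derive_withinE (@convex_halfline R) _ (oner_neq0 R)).
- by rewrite /= in_itv /= lexx.
- by rewrite /= [1 *: 1]mulr1 addr0 in_itv /= ler01.
Qed.

Lemma eq_slab_integral (tau b1 b2 : R) (f g : 'rV[R]_2 -> R) :
  a1 <= b1 -> b2 <= a2 -> {in D, f =1 g} ->
  slab_integral tau b1 b2 f = slab_integral tau b1 b2 g.
Proof.
move=> ab ba fg; apply: eq_Rintegral => -[t x].
rewrite inE => -[]; rewrite /= !in_itv /= => /andP[t0 _] /andP[x1 x2].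
apply: fg; rewrite inE; apply: spacetime_event => //.
by rewrite (le_lt_trans ab x1) (lt_le_trans x2 ba).
Qed.

Lemma row_event (u : 'I_2 -> R) : \row_mu u mu = event (u 0) (u 1).
Proof.
by apply/rowP => i; have [->|->] := ord2_eq i; rewrite mxE (event0, event1).
Qed.

Lemma cvg_row (U : Type) (F : set_system U) (u : 'I_2 -> U -> R) (l : 'I_2 -> R) :
  Filter F -> (forall mu, u mu x @[x --> F] --> l mu) ->
  \row_mu u mu x @[x --> F] --> \row_mu l mu.
Proof.
move=> FF ul; rewrite row_event.
have -> : (fun x => \row_mu u mu x) = (fun x => event (u 0 x) (u 1 x)).
  by apply/funext => x; rewrite row_event.
by apply: cvgD; apply: cvgZr_tmp; exact: ul.
Qed.

End fields.

(** * Divergence of the Noether current *)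

Theorem theorem2 (R : realType) (a1 a2 rho0 c : R)
    (I : 'rV[R]_2 -> R) (Il : R -> 'rV[R]_2 -> R)
    (K : 'I_2 -> R * 'rV[R]_2 -> R) :
  a1 < a2 ->
  transformation_of a1 a2 Il I ->
  euler_lagrange a1 a2 (sigma rho0 c) I ->
  (forall mu, smooth_within setT (K mu)) ->
  variational_invariance a1 a2 (sigma rho0 c) Il I K ->
  conservation_law a1 a2 (current a1 a2 (sigma rho0 c) Il I K).
Proof.
move=> _ [smF F0] EL smK inv.
pose D := spacetime a1 a2.
pose L : set R := `[0%R, +oo[%classic.
pose F (w : 'rV[R]_2 * R) := Il w.2 w.1.
pose m := modulus rho0 c.
have L0 : L 0 by rewrite /L /= in_itv /= lexx.
have L1 : L (1 + 0) by rewrite /L /= addr0 in_itv /= ler01.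
have cvD : convex_domain D by exact: convex_spacetime.
have cvL : convex_domain L by exact: convex_halfline.
(* The witnesses introduced from here on are [g mu] for the derivative of [F] along [mu], [G] for
   the one in lambda, [gl mu] for the lambda-derivative of [g mu], and [gg (mu, nu)] for the
   derivative of [g mu] along [nu]. *)
have [cF dF] := smF 2%N.
have /choice[g gP] (mu : 'I_2) := dF (e mu, 0).
have [G [dG [cG _]]] := dF (0, 1).
have dg mu w : (D `*` L) w -> is_derive_within (D `*` L) F w (e mu, 0) (g mu w).
  exact: (gP mu).1.
have cg mu : {within D `*` L, continuous (g mu)} by exact: (gP mu).2.1.
have /choice[gl glP] (mu : 'I_2) := (gP mu).2.2 (0, 1).
have dgl mu w : (D `*` L) w -> is_derive_within (D `*` L) (g mu) w (0, 1) (gl mu w).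
  exact: (glP mu).1.
have cgl mu : {within D `*` L, continuous (gl mu)} by exact: (glP mu).2.1.
have /choice[gg ggP] (i : 'I_2 * 'I_2) := (gP i.1).2.2 (e i.2, 0).
have dgg mu nu w : (D `*` L) w ->
    is_derive_within (D `*` L) (g mu) w (e nu, 0) (gg (mu, nu) w).
  exact: (ggP (mu, nu)).1.
have cgg i : {within D `*` L, continuous (gg i)} by exact: (ggP i).2.1.
have slice (f : 'rV[R]_2 * R -> R) : {within D `*` L, continuous f} ->
    {within D, continuous (fun z => f (z, 0))}.
  exact: within_continuous_slicel.
(* The exchange of derivatives: the generator is differentiable along [mu], with derivative [gl mu]
   at lambda 0. *)
have dGs mu z : D z -> is_derive_within D (fun x => G (x, 0)) z (e mu) (gl mu (z, 0)).
  move=> Dz; exact: (is_derive_within_exchange cvD cvL cF (cg mu) (cgl mu)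
    (dg mu) (dgl mu) dG Dz L0 (oner_neq0 R) L1).
have dggs mu nu z : D z ->
    is_derive_within D (fun x => g mu (x, 0)) z (e nu) (gg (mu, nu) (z, 0)).
  by move=> Dz; apply: (is_derive_within_slicel (F := g mu) L0); exact: dgg.
have dFs mu z : D z -> is_derive_within D (fun x => F (x, 0)) z (e mu) (g mu (z, 0)).
  by move=> Dz; apply: (is_derive_within_slicel (F := F) L0); exact: dg.
have gradl lam z : L lam -> D z -> grad a1 a2 (Il lam) z = \row_mu g mu (z, lam).
  move=> Llam Dz; apply/rowP => mu; rewrite !mxE.
  apply: (partialE (f := fun x => F (x, lam)) Dz) => //.
  by apply: (is_derive_within_slicel (F := F) Llam); exact: dg.
have gradI z : D z -> grad a1 a2 I z = \row_mu g mu (z, 0).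
  move=> Dz; apply/rowP => mu; rewrite !mxE.
  apply: (partialE (f := fun x => F (x, 0)) Dz); last exact: dFs.
  by move=> x; rewrite inE; exact: F0.
have genE z : D z -> generator Il z = G (z, 0).
  by move=> Dz; apply: generatorE; apply: (is_derive_within_slicer (F := F) Dz); exact: dG.
have momE mu z : D z -> momentum a1 a2 (sigma rho0 c) I mu z = m mu * g mu (z, 0).
  by move=> Dz; rewrite /momentum derive_sigma gradI // mxE.
have KP v mu : exists k, (forall y, is_derive_within setT (K mu) y v (k y)) /\
    {within setT, continuous k}.
  have [_ /(_ v)[k [dk [ck _]]]] := smK mu 1%N.
  by exists k; split => // y; exact: dk.
have /choice[k0 k0P] := KP (1, 0).
have /choice[k1 k1P] := KP (0, e 0).
have /choice[k2 k2P] := KP (0, e 1).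
have cK mu : {within setT, continuous (K mu)} by have [] := smK mu 0%N.
(* On the domain [q] is the argument at which [along] evaluates [K], written with the witnesses so
   that continuity and derivatives are available. *)
pose q z := (F (z, 0), \row_mu g mu (z, 0)).
pose dK mu nu z := gg (1, nu) (z, 0) * k2 mu (q z) +
  (gg (0, nu) (z, 0) * k1 mu (q z) + g nu (z, 0) * k0 mu (q z)).
have dKP mu nu z : D z -> is_derive_within D (K mu \o q) z (e nu) (dK mu nu z).
  move=> Dz; apply: (is_derive_within_chain (m := fun i => gg (i, nu) (z, 0))
    (w := fun i x => g i (x, 0)) (cK mu) (k0P mu).2 (k1P mu).2 (k2P mu).2
    (k0P mu).1 (k1P mu).1 (k2P mu).1 (dFs nu z Dz)) => i.
  exact: dggs.
have alongE mu z : D z -> along a1 a2 K I mu z = K mu (q z).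
  by move=> Dz; rewrite /along gradI // /q -F0.
have cq : {within D, continuous q}.
  apply/subspace_continuousP => z Dz.
  apply: (cvg_pair (G := nbhs (F (z, 0))) (H := nbhs (\row_mu g mu (z, 0)))).
    by move/subspace_continuousP : (slice _ cF); exact.
  apply: cvg_row => mu.
  by move/subspace_continuousP : (slice _ (cg mu)); exact.
have cdK mu nu : {within D, continuous (dK mu nu)}.
  have ckq (k : R * 'rV[R]_2 -> R) : {within setT, continuous k} -> {within D, continuous (k \o q)}.
    by move=> ck; exact: (within_continuousT_comp (fun _ _ => Logic.I) cq ck).
  apply: within_continuousD.
    by apply: within_continuousM; [exact: slice|exact: ckq (k2P mu).2].
  apply: within_continuousD.
    by apply: within_continuousM; [exact: slice|exact: ckq (k1P mu).2].
  by apply: within_continuousM; [exact: slice|exact: ckq (k0P mu).2].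
pose k z := dK 0 0 z + dK 1 1 z.
have divK z : D z -> divergence a1 a2 (along a1 a2 K I) z = k z.
  move=> Dz; rewrite /divergence sum2; congr (_ + _);
    apply: (partialE (f := K _ \o q) Dz); try exact: dKP;
    by move=> x; rewrite inE => Dx; rewrite alongE.
(* [S] is the density of the transformed field and [T] its lambda-derivative; the 2 from the squares
   cancels the factor one half. *)
pose S lam z := 2^-1 * (m 0 * (g 0 (z, lam) * g 0 (z, lam)) +
  m 1 * (g 1 (z, lam) * g 1 (z, lam))).
pose T lam z := m 0 * (g 0 (z, lam) * gl 0 (z, lam)) + m 1 * (g 1 (z, lam) * gl 1 (z, lam)).
have TK z : D z -> T 0 z = k z.
  have cmul (f h : 'rV[R]_2 * R -> R) x :
      {within D `*` L, continuous f} -> {within D `*` L, continuous h} ->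
      {within D `*` L, continuous (fun w => x * (f w * h w))}.
    by move=> cf ch; apply: within_continuousZ; exact: within_continuousM.
  have pairE (f : 'rV[R]_2 * R -> R) : (fun w => f (w.1, w.2)) = f.
    by apply/funext => -[].
  apply: (localization (S := S) (k := k)).
  - have cs : {within D `*` L, continuous (fun w =>
        2^-1 * (m 0 * (g 0 w * g 0 w) + m 1 * (g 1 w * g 1 w)))}.
      by apply: within_continuousZ; apply: within_continuousD; exact: cmul.
    by rewrite -[X in continuous X]pairE in cs.
  - have ct : {within D `*` L, continuous (fun w =>
        m 0 * (g 0 w * gl 0 w) + m 1 * (g 1 w * gl 1 w))}.
      by apply: within_continuousD; exact: cmul.
    by rewrite -[X in continuous X]pairE in ct.
  - by apply: within_continuousD; exact: cdK.
  - move=> x lam Dx Llam.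
    have d mu : is_derive_within L (fun s => g mu (x, s)) lam 1 (gl mu (x, lam)).
      by apply: (is_derive_within_slicer (F := g mu) Dx); exact: dgl.
    have d2 mu := is_derive_withinZ (c := m mu) (is_derive_withinM (d mu) (d mu)).
    have := is_derive_withinZ (c := 2^-1) (is_derive_withinD (d2 0) (d2 1)).
    have -> : 2^-1 * (m 0 * (gl 0 (x, lam) * g 0 (x, lam) + g 0 (x, lam) * gl 0 (x, lam)) +
      m 1 * (gl 1 (x, lam) * g 1 (x, lam) + g 1 (x, lam) * gl 1 (x, lam))) = T lam x.
      by rewrite /T; field.
    exact.
  - move=> tau b1 b2 tau0 ab bb ba.
    rewrite -(@eq_slab_integral _ a1 a2 _ _ _ (divergence a1 a2 (along a1 a2 K I))) //; last first.
      by move=> x; rewrite inE; exact: divK.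
    (* The density agrees with [S] only on the domain and for nonnegative lambda, which is all that
       the slab integrals and the one-sided derivative see. *)
    apply: eq_is_derive_within (inv tau b1 b2 tau0 ab bb ba) => // lam.
    rewrite inE => Llam; apply: (@eq_slab_integral _ a1 a2) => // x.
    rewrite inE => Dx; rewrite gradl // /sigma !mxE /S /m /modulus /=.
    by rewrite !expr2 mulNr.
move=> z Dz.
pose dP mu := m mu * gg (mu, mu) (z, 0) * G (z, 0) + m mu * g mu (z, 0) * gl mu (z, 0) - dK mu mu z.
pose P mu x := m mu * g mu (x, 0) * G (x, 0) - K mu (q x).
have PE mu : {in D, P mu =1 current a1 a2 (sigma rho0 c) Il I K mu}.
  by move=> x; rewrite inE => Dx; rewrite /current momE // genE // alongE.
have dPP mu : is_derive_within D (P mu) z (e mu) (dP mu).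
  apply: is_derive_withinB (dKP mu mu z Dz).
  by apply: is_derive_withinM (dGs mu z Dz); apply: is_derive_withinZ; exact: dggs.
split=> [mu|].
  by exists (dP mu); exact: eq_is_derive_within (PE mu) (dPP mu).
have el := EL z Dz.
have dm mu : partial a1 a2 mu (momentum a1 a2 (sigma rho0 c) I mu) z = m mu * gg (mu, mu) (z, 0).
  apply: (partialE (f := fun x => m mu * g mu (x, 0)) Dz).
    by move=> x; rewrite inE => Dx; rewrite momE.
  by apply: is_derive_withinZ; exact: dggs.
rewrite /divergence sum2 !dm in el.
rewrite /divergence sum2 !(partialE Dz (PE _) (dPP _)).
have := TK z Dz; rewrite /T /k /dP => tk.
(* Regrouped this way, the coefficient of the generator is the Euler-Lagrange expression, and the
   remainder is [T 0 z - k z], up to the order of factors. *)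
have -> : forall x0 x1 y0 y1 u0 u1 v : R, x0 * v + y0 - u0 + (x1 * v + y1 - u1) =
   (x0 + x1) * v + (y0 + y1 - (u0 + u1)) by move=> *; ring.
by rewrite el -tk; ring.
Qed.
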